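(* Let $\mathcal{A}=(a_{ijk})$ be a 3rd order 3-dimensional real symmetric tensor with $a_{iii}>0$ for all $i\in\{1,2,3\}$. Assume that $a_{123}\ge\sqrt[3]{a_{111}a_{222}a_{333}}$ and that there exist $r,s,t\in\{1,2,3\}$ with $r\neq s$, $s\neq t$, $r\neq t$ such that $$\begin{aligned} &a_{rss}\ge\sqrt[3]{a_{rrr}a_{sss}^2},\quad a_{rtt}\ge\sqrt[3]{a_{rrr}a_{ttt}^2},\\ &a_{rrs}\ge-\sqrt[3]{a_{rrr}^2a_{sss}},\quad a_{rrt}\ge-\sqrt[3]{a_{rrr}^2a_{ttt}},\quad a_{sst}\ge0,\quad a_{stt}\ge0. \end{aligned}$$ Then $\mathcal{A}$ is strictly copositive.
   Context: A 3rd order 3-dimensional real symmetric tensor is an array $\mathcal{A}=(a_{ijk})_{1\le i,j,k\le 3}$ of real numbers whose entries are invariant under every permutation of the indices. For $x=(x_1,x_2,x_3)^\top\in\mathbb{R}^3$ put $\mathcal{A}x^3=\sum_{i,j,k=1}^3 a_{ijk}x_ix_jx_k$. $\mathcal{A}$ is strictly copositive if $\mathcal{A}x^3>0$ for every $x\neq 0$ with $x_1,x_2,x_3\ge 0$. *)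

(* Defs.v *)
From HB Require Import structures.
From mathcomp Require Import all_boot all_order all_fingroup all_algebra.
From mathcomp Require Import all_classical all_reals all_analysis.

Set Implicit Arguments.
Unset Strict Implicit.
Unset Printing Implicit Defensive.

Import Order.TTheory GRing.Theory Num.Theory.
Local Open Scope ring_scope.

(* Indices run over 'I_n, so the index written i in 1-based notation is i - 1
   here; numerals 0, 1, 2 : 'I_3 are the elements of Z/3Z. *)
Definition tensor3 (R : Type) (n : nat) := 'I_n -> 'I_n -> 'I_n -> R.

Definition symmetric_tensor (R : Type) (n : nat) (a : tensor3 R n) : Prop :=
  forall (p : 'S_3) (i : 'I_3 -> 'I_n),
    a (i (p 0)) (i (p 1)) (i (p 2)) = a (i 0) (i 1) (i 2).

Definition cubic_form (R : realType) (n : nat) (a : tensor3 R n)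
    (x : 'cV[R]_n) : R :=
  \sum_(i < n) \sum_(j < n) \sum_(k < n)
    a i j k * x i 0 * x j 0 * x k 0.

Definition strictly_copositive (R : realType) (n : nat)
    (a : tensor3 R n) : Prop :=
  forall x : 'cV[R]_n,
    x != 0 -> (forall i, 0 <= x i 0) -> 0 < cubic_form a x.

(* [powR] is the usual real power on nonnegative arguments only, so this is the
   cube root for x >= 0; it is not the odd extension to x < 0. *)
Definition cbrt (R : realType) (x : R) : R := powR x (3%:R^-1).

(* Main.v *)
(* With u, v, w >= 0 the coordinates x_r, x_s, x_t rescaled by the cube roots of
   the diagonal entries and p = v + w, the hypotheses bound the cubic form below
   by v^3 + w^3 + u (u^2 - 3 u p + 3 p^2), whose quadratic factor is positive
   definite. *)
Require Import Defs.
From HB Require Import structures.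
From mathcomp Require Import all_boot all_order all_fingroup all_algebra.
From mathcomp Require Import all_classical all_reals all_analysis.
From mathcomp Require Import ring lra.
Import Order.TTheory GRing.Theory Num.Theory.
Local Open Scope ring_scope.

Lemma ord3P (P : 'I_3 -> Prop) : P 0 -> P 1 -> P 2 -> forall i, P i.
Proof.
move=> P0 P1 P2 [[|[|[|//]]] lti].
- by rewrite (_ : Ordinal lti = 0) //; apply/val_inj.
- by rewrite (_ : Ordinal lti = 1) //; apply/val_inj.
- by rewrite (_ : Ordinal lti = 2) //; apply/val_inj.
Qed.

Lemma big_ord3 (T : Type) (idx : T) (op : Monoid.law idx) (F : 'I_3 -> T) :
  \big[op/idx]_i F i = op (op (F 0) (F 1)) (F 2).
Proof.
rewrite !big_ord_recr big_ord0 /= Monoid.mul1m.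
by congr (op (op (F _) (F _)) (F _)); apply/val_inj.
Qed.

(** Packaging the triple as a permutation lets sums and products over ['I_3] be reindexed in the
    order [r], [s], [t], with no case split on the six possible orders. *)
Lemma perm3_of_distinct (r s t : 'I_3) :
  r != s -> s != t -> r != t ->
  exists p : 'S_3, [/\ p 0 = r, p 1 = s & p 2 = t].
Proof.
move=> rs st rt.
pose f (i : 'I_3) := if i == 0 then r else if i == 1 then s else t.
have f_inj : injective f.
  by apply: ord3P; apply: ord3P => // /eqP;
    rewrite /f /= ?(negPf rs) ?(negPf st) ?(negPf rt) 1?eq_sym
      ?(negPf rs) ?(negPf st) ?(negPf rt).
by exists (perm f_inj); rewrite !permE.
Qed.

Section Cbrt.
Variable R : realType.
Implicit Types x y : R.

Lemma cbrt_gt0 x : 0 < x -> 0 < cbrt x.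
Proof. exact: powR_gt0. Qed.

Lemma cbrtK x : 0 <= x -> cbrt x ^+ 3 = x.
Proof.
move=> x0; rewrite -powR_mulrn ?powR_ge0// -powRrM mulVf ?pnatr_eq0//.
exact: powRr1.
Qed.

Lemma cbrtM x y : 0 <= x -> 0 <= y -> cbrt (x * y) = cbrt x * cbrt y.
Proof. exact: powRM. Qed.

End Cbrt.

Section Tensor3.
Context {R : realType} {n : nat} {a : tensor3 R n}.
Hypothesis a_sym : symmetric_tensor a.

Lemma symmetric_tensor_swapl i j k : a i j k = a j i k.
Proof.
(* Symmetry acts on the positions of an index word; [f] is the word [i], [j], [k]. *)
pose f (l : 'I_3) := if l == 0 then i else if l == 1 then j else k.
have := a_sym (tperm 0 1) f.
by rewrite tpermL tpermR tpermD.
Qed.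

Lemma symmetric_tensor_swapr i j k : a i j k = a i k j.
Proof.
pose f (l : 'I_3) := if l == 0 then i else if l == 1 then j else k.
have := a_sym (tperm 1 2) f.
by rewrite tpermL tpermR tpermD.
Qed.

End Tensor3.

(** The 27 terms are grouped by index multiset: 3 and 6 count the arrangements of a word with two or
    three distinct letters. *)
Lemma cubic_form3 (R : realType) (a : tensor3 R 3) (x : 'cV[R]_3) (p : 'S_3) :
  symmetric_tensor a ->
  let r := p 0 in let s := p 1 in let t := p 2 in
  cubic_form a x =
    a r r r * x r 0 ^+ 3 + a s s s * x s 0 ^+ 3 + a t t t * x t 0 ^+ 3
    + 3 * (a r r s * x r 0 ^+ 2 * x s 0 + a r r t * x r 0 ^+ 2 * x t 0
         + a r s s * x r 0 * x s 0 ^+ 2 + a r t t * x r 0 * x t 0 ^+ 2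
         + a s s t * x s 0 ^+ 2 * x t 0 + a s t t * x s 0 * x t 0 ^+ 2)
    + 6 * (a r s t * x r 0 * x s 0 * x t 0).
Proof.
move=> a_sym r s t.
have swapl := symmetric_tensor_swapl a_sym.
have swapr := symmetric_tensor_swapr a_sym.
have sumE (F : 'I_3 -> R) : \sum_i F i = F r + F s + F t.
  by rewrite (reindex_inj (@perm_inj _ p)) big_ord3.
rewrite /cubic_form !sumE.
(* Every index word is sorted in the order [r], [s], [t], so that [ring] sees equal coefficients as
   the same atom. *)
rewrite (swapl s r r) (swapr r s r) (swapl t r r) (swapr r t r).
rewrite (swapr s s r) (swapl s r s) (swapr t t r) (swapl t r t).
rewrite (swapl t s s) (swapr s t s) (swapr t t s) (swapl t s t).
rewrite (swapr s t r) (swapl s r t).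
rewrite (swapr t s r) (swapl t r s) (swapr r t s).
ring.
Qed.

Lemma cubic_lower_bound_gt0 (R : realFieldType) (u v w : R) :
  0 <= u -> 0 <= v -> 0 <= w -> (0 < u) || (0 < v) || (0 < w) ->
  0 < u ^+ 3 + v ^+ 3 + w ^+ 3
    + 3 * (- (u ^+ 2 * v) - u ^+ 2 * w + u * v ^+ 2 + u * w ^+ 2)
    + 6 * (u * v * w).
Proof.
(* The term [6 * (u * v * w)] completes [3 * u * (v ^+ 2 + w ^+ 2)] to [3 * u * (v + w) ^+ 2], which
   makes [u] times the quadratic [q] appear. *)
move=> u0 v0 w0 uvw; pose q := u ^+ 2 - 3 * u * (v + w) + 3 * (v + w) ^+ 2.
rewrite (_ : _ + _ = u * q + v ^+ 3 + w ^+ 3); last by rewrite /q; ring.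
have qE : q = u ^+ 2 / 4 + 3 * (v + w - u / 2) ^+ 2 by rewrite /q; field.
have q0 : 0 <= q.
  by rewrite qE; have := sqr_ge0 u; have := sqr_ge0 (v + w - u / 2); lra.
have := mulr_ge0 u0 q0; have := exprn_ge0 3 v0; have := exprn_ge0 3 w0.
case/orP: uvw => [/orP[]|] h.
(* If [u > 0], the summand [u ^+ 2 / 4] already makes [q] positive; in the other two cases a pure
   cube is positive. *)
- suff : 0 < u * q by lra.
  have := sqr_ge0 (v + w - u / 2); have := exprn_gt0 2 h.
  by move=> u2 sq; rewrite mulr_gt0// qE; lra.
- have := exprn_gt0 3 h; lra.
- have := exprn_gt0 3 h; lra.
Qed.

Theorem corollary3p7 (R : realType) (a : tensor3 R 3)
    (a_sym : symmetric_tensor a)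
    (a_diag : forall i : 'I_3, 0 < a i i i)
    (a_012 : cbrt (a 0 0 0 * a 1 1 1 * a 2 2 2) <= a 0 1 2)
    (a_rst : exists r s t : 'I_3,
      [/\ r != s, s != t & r != t] /\
      [/\ cbrt (a r r r * a s s s ^+ 2) <= a r s s
        & cbrt (a r r r * a t t t ^+ 2) <= a r t t] /\
      [/\ - cbrt (a r r r ^+ 2 * a s s s) <= a r r s,
          - cbrt (a r r r ^+ 2 * a t t t) <= a r r t,
          0 <= a s s t
        & 0 <= a s t t]) :
  strictly_copositive a.
Proof.
move=> x x_neq0 x_ge0.
case: a_rst => r [s] [t] [[rs st rt] [[rss rtt] [rrs rrt sst stt]]].
have [p [pr ps pt]] := perm3_of_distinct _ _ _ rs st rt.
have rst : cbrt (a r r r * a s s s * a t t t) <= a r s t.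
  (* Both sides of the hypothesis on [a 0 1 2] are invariant under [p]: the entry by symmetry, the
     diagonal product by reindexing. *)
  have -> : a r s t = a 0 1 2 by rewrite -pr -ps -pt; exact: (a_sym p id).
  have : \prod_i a i i i = \prod_i a (p i) (p i) (p i).
    exact: reindex_inj (@perm_inj _ p).
  by rewrite !big_ord3 pr ps pt /= => <-.
have ge0 i : 0 <= a i i i := ltW (a_diag i).
pose c i := cbrt (a i i i).
have c_gt0 i : 0 < c i := cbrt_gt0 _ _ (a_diag i).
have cE i : a i i i = c i ^+ 3 by rewrite cbrtK.
have cbrtM2 i j : cbrt (a i i i ^+ 2 * a j j j) = c i ^+ 2 * c j.
  by rewrite expr2 !cbrtM ?mulr_ge0// -expr2.
(* From here on every cube-root bound is a monomial in the [c i], matching the scaled coordinates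
   [c i * x i 0]. *)
rewrite mulrC cbrtM2 in rss; rewrite mulrC cbrtM2 in rtt.
rewrite cbrtM2 in rrs; rewrite cbrtM2 in rrt.
rewrite !cbrtM ?mulr_ge0// -!/(c _) in rst.
have uvw : (0 < c r * x r 0) || (0 < c s * x s 0) || (0 < c t * x t 0).
  rewrite !pmulr_rgt0// !lt_def !x_ge0 !andbT -!negb_and.
  (* If no scaled coordinate is positive, [x] vanishes at [r], [s] and [t], which are all the
     indices since [p] is onto. *)
  apply: contra x_neq0 => /andP[/andP[xr xs] xt].
  apply/eqP/matrixP => i j; rewrite ord1 mxE -(permKV p i).
  by elim/ord3P: (p^-1%g i); rewrite (pr, ps, pt); apply/eqP.
have cx_ge0 i : 0 <= c i * x i 0 := mulr_ge0 (ltW (c_gt0 i)) (x_ge0 i).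
apply: lt_le_trans
  (cubic_lower_bound_gt0 _ _ _ _ (cx_ge0 r) (cx_ge0 s) (cx_ge0 t) uvw) _.
rewrite (cubic_form3 _ _ x p a_sym) pr ps pt !cE.
(* Each coefficient bound is multiplied by its nonnegative monomial; the comparison is then linear
   in these products. The [sst] and [stt] terms are bounded below by 0. *)
have mon i j k y z : z <= y ->
    z * (x i 0 * x j 0 * x k 0) <= y * (x i 0 * x j 0 * x k 0).
  by move=> zy; rewrite ler_wpM2r// !mulr_ge0.
have := mon r r s _ _ rrs; have := mon r r t _ _ rrt.
have := mon r s s _ _ rss; have := mon r t t _ _ rtt.
have := mon s s t _ _ sst; have := mon s t t _ _ stt.
have := mon r s t _ _ rst.
lra.
Qed.
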